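(* For every $0<\alpha\le 1/4$, define $$R_{\alpha}\triangleq h(\alpha)-\frac12 h(2\alpha)+(1-\alpha)\left[h\left(\Gamma^{-1}\left(\frac{\alpha}{1-\alpha}\right)\right)+1-\Gamma^{-1}\left(\frac{\alpha}{1-\alpha}\right)\right].$$ Then the optimal rate $R$ for unique-sum pairs satisfies $$R\le \inf_{0<\alpha\le 1/4}R_\alpha .$$
   Context: $\log$ denotes the base-2 logarithm. Unique-sum pairs. For a positive integer $n$ and nonempty subsets $\mathcal X,\mathcal Y\subseteq\{0,1\}^n$, the pair $(\mathcal X,\mathcal Y)$ is an $n$-dimensional unique-sum pair if the map $(\boldsymbol x,\boldsymbol y)\mapsto \boldsymbol x+\boldsymbol y$ (componentwise integer addition, with values in $\{0,1,2\}^n$) is injective on $\mathcal X\times\mathcal Y$. Let $M(n)$ be the maximum of $|\mathcal X||\mathcal Y|$ over all $n$-dimensional unique-sum pairs $(\mathcal X,\mathcal Y)$. The optimal rate is $R\triangleq\lim_{n\to\infty}\frac1n\log M(n)$ (this limit is known to exist, by Lindström 1969). Functions. The binary entropy function is $h(p)=-p\log p-(1-p)\log(1-p)$ for $p\in[0,1]$, with $0\log 0=0$. Define $$\Gamma(\alpha)=1+h(\alpha)-2h\left(\frac{1-\sqrt{1-2\alpha}}{2}\right),\qquad \alpha\in[0,1/2].$$ The function $\Gamma$ is continuous and strictly decreasing on $[1/3,1/2]$ with $\Gamma(1/3)>1/3$ and $\Gamma(1/2)=0$; $\Gamma^{-1}$ denotes the inverse of the restriction of $\Gamma$ to $[1/3,1/2]$,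 so for $\beta\in[0,1/3]$, $\Gamma^{-1}(\beta)$ is the unique $\lambda\in[1/3,1/2]$ with $\Gamma(\lambda)=\beta$ (and in fact $\lambda\in(1/3,1/2]$). *)

(* Defs.v *)
From HB Require Import structures.
From mathcomp Require Import all_boot all_order all_algebra.
From mathcomp Require Import all_classical all_reals all_analysis.
Set Implicit Arguments. Unset Strict Implicit. Unset Printing Implicit Defensive.
Import Order.TTheory GRing.Theory Num.Theory.
Import numFieldNormedType.Exports.
Local Open Scope classical_set_scope.
Local Open Scope ring_scope.

Definition cube (n : nat) := {ffun 'I_n -> bool}.

(* Booleans are coerced to 0 and 1: the sum takes values in {0,1,2}^n. *)
Definition vsum (n : nat) (xy : cube n * cube n) : {ffun 'I_n -> nat} :=
  [ffun i => (xy.1 i + xy.2 i)%N].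

Definition unique_sum_pair (n : nat) (X Y : {set cube n}) : bool :=
  [&& X != finset.set0, Y != finset.set0 &
      dinjectiveb (@vsum n) (finset.setX X Y)].

Lemma unique_sum_pairP (n : nat) (X Y : {set cube n}) :
  reflect [/\ X != finset.set0, Y != finset.set0 &
             {in finset.setX X Y &, injective (@vsum n)}]
          (unique_sum_pair X Y).
Proof.
by apply: (iffP and3P) => -[hX hY /dinjectiveP hXY]; split=> //;
  apply/dinjectiveP.
Qed.

Definition max_unique_sum (n : nat) : nat :=
  \max_(XY : {set cube n} * {set cube n} | unique_sum_pair XY.1 XY.2)
     (#|XY.1| * #|XY.2|)%N.

Definition log2 (R : realType) (x : R) : R := ln x / ln 2.

Definition optimal_rate (R : realType) : R :=
  limn (fun n : nat => log2 (max_unique_sum n)%:R / n%:R : R).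

(* At p = 0 and p = 1 the factor 0 makes the corresponding term vanish. *)
Definition entropy (R : realType) (p : R) : R :=
  - p * log2 p - (1 - p) * log2 (1 - p).

Definition Gamma (R : realType) (a : R) : R :=
  1 + entropy a - 2 * entropy ((1 - Num.sqrt (1 - 2 * a)) / 2).

(* Inverse of the restriction of Gamma to [1/3, 1/2]; the default value 0 is
   only taken outside the image Gamma @` [1/3, 1/2]. *)
Definition Gamma_inv (R : realType) : R -> R :=
  'pinv_(fun=> 0) `[1 / 3, 1 / 2]%classic (@Gamma R).

Definition Rate (R : realType) (a : R) : R :=
  entropy a - 1 / 2 * entropy (2 * a)
  + (1 - a) * (entropy (Gamma_inv (a / (1 - a))) + 1
               - Gamma_inv (a / (1 - a))).

(* Main.v *)
Require Import Defs.
From mathcomp Require Import all_boot all_order all_algebra.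
From mathcomp Require Import all_classical all_reals all_analysis.
From mathcomp Require Import ring lra zify.
Set Implicit Arguments.
Unset Strict Implicit.
Unset Printing Implicit Defensive.
Import Order.TTheory GRing.Theory Num.Theory.
Import numFieldNormedType.Exports.
Local Open Scope classical_set_scope.
Local Open Scope ring_scope.

(** Why the bound holds. Let (X, Y) be a unique-sum pair in dimension n = 2N, let D(x, y)
be the set of coordinates where x and y differ, and let S be a set of k ~ a n coordinates.
On the pairs with S included in D(x, y) the sum x + y is constantly 1 on S, so these pairs
are still told apart by their sums on the m = n - k other coordinates. Call P_S the set of
these pairs.

Double counting gives a large P_S. Complementing every word of Y preserves the unique-sum
property (differences of X and Y are as injective as sums) and replaces D(x, y) by its
complement; one of the two sets has at least N elements, hence contains at least 'C(N, k)
sets S. Summing over S, |X| |Y| 'C(N, k) is at most 'C(2N, k) times twice any common upper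
bound on |P_S| (card_product_le). For k ~ a n the quotient of binomials costs
h(a) - h(2 a) / 2 per coordinate.

The size of P_S is bounded in two ways, according to the average fraction l of the
coordinates outside S on which x and y differ; lam denotes Gamma_inv (a / (1 - a)).
- Always, log |P_S| <= m (h(l) + 1 - l): a sum is determined by the places of its 1s and by
  a bit at each other place. This is nonincreasing in l for l >= 1/3, so it gives the claim
  log |P_S| <= m (h(lam) + 1 - lam) if l >= lam (cut_pairs_large_distance).
- Given the restriction of x to S, which takes at most 2^k values and determines that of y,
  the pair (x, y) ranges over a product set. So log |P_S| is at most k plus the sum of the
  entropies of the coordinates of x + y, where now x_i and y_i are independent. Two
  independent bits that differ with probability l have a sum of entropy at most
  2 h(p) - l where 2 p (1 - p) = l, and this is concave and increasing in l. For l <= lam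
  this gives log |P_S| <= k + m (2 h(p) - lam) with 2 p (1 - p) = lam
  (cut_pairs_small_distance). As Gamma lam = 1 + h(lam) - 2 h(p) and
  k / m <= a / (1 - a) = Gamma lam, this is at most the same bound m (h(lam) + 1 - lam).

Both counting bounds are instances of Gibbs' inequality for a code (code_entropy_le).
Finally the maximum is supermultiplicative in n, so the normalized logarithms converge
(superadditive_cvg), and even dimensions suffice to bound the limit. Entropies are measured
in nats until the last step. *)

(** * Entropy of a biased bit *)

Lemma ln2_gt0 (R : realType) : 0 < ln 2 :> R.
Proof. by rewrite ln_gt0// ltr1n. Qed.

Lemma lnM3 (R : realType) (x y z : R) : 0 < x -> 0 < y -> 0 < z ->
  ln (x * y * z) = ln x + ln y + ln z.
Proof. by move=> x0 y0 z0; rewrite !lnM ?posrE ?mulr_gt0. Qed.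

Lemma le_of_derive_ge0 (R : realType) (f df : R -> R) (a b : R) : a <= b ->
  (forall x, a <= x <= b -> is_derive x 1 f (df x)) ->
  (forall x, a <= x <= b -> 0 <= df x) -> f a <= f b.
Proof.
move=> ab fdf df0; rewrite -subr_ge0.
have [||c cab ->] := @MVT_segment R f df a b ab.
- by move=> x /[!in_itv]/= /andP[ax xb]; apply: fdf; rewrite !ltW.
- apply: derivable_within_continuous => x /[!in_itv]/= xab.
  by have [] := fdf _ xab.
by rewrite mulr_ge0 ?subr_ge0//; apply: df0; move: cab; rewrite in_itv.
Qed.

(** The log-odds of a bit whose two values have probabilities (1 + x) / 2 and (1 - x) / 2. *)
Definition log_odds (R : realType) (x : R) : R := ln (1 + x) - ln (1 - x).

(** Twice the amount by which the entropy of a bit with probabilities (1 + x) / 2 and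
(1 - x) / 2 falls short of [ln 2]; its derivative is the log-odds. *)
Definition entropy_deficit (R : realType) (x : R) : R :=
  (1 + x) * ln (1 + x) + (1 - x) * ln (1 - x).

Lemma is_derive_lnD1 (R : realType) (x : R) : -1 < x ->
  is_derive x 1 (fun y => ln (1 + y) : R) (1 + x)^-1.
Proof.
move=> x1.
have h : is_derive x 1 (fun y : R => 1 + y) 1.
  have -> : (fun y : R => 1 + y) = cst 1 + id by [].
  by apply: is_derive_eq; rewrite add0r.
have h2 : is_derive (1 + x) 1 (@ln R) (1 + x)^-1 by apply: is_derive1_ln; lra.
by have := is_derive1_comp h2 h; rewrite mulr1.
Qed.

Lemma is_derive_lnB1 (R : realType) (x : R) : x < 1 ->
  is_derive x 1 (fun y => ln (1 - y) : R) (- (1 - x)^-1).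
Proof.
move=> x1.
have h : is_derive x 1 (fun y : R => 1 - y) (-1).
  have -> : (fun y : R => 1 - y) = cst 1 - id by [].
  by apply: is_derive_eq; rewrite sub0r.
have h2 : is_derive (1 - x) 1 (@ln R) (1 - x)^-1 by apply: is_derive1_ln; lra.
by have := @is_derive1_comp R (@ln R) (fun y => 1 - y) x _ _ h2 h; rewrite mulrN1.
Qed.

Lemma is_derive_log_odds (R : realType) (x : R) : -1 < x < 1 ->
  is_derive x 1 (@log_odds R) (2 / (1 - x ^+ 2)).
Proof.
move=> /andP[x0 x1].
have := is_derive_lnD1 x0; have := is_derive_lnB1 x1 => h1 h2.
have -> : @log_odds R = (fun y => ln (1 + y)) - (fun y => ln (1 - y)) by [].
apply: is_derive_eq.
by field; apply/andP; split; [nra|apply/andP; split; lra].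
Qed.

Lemma is_derive_entropy_deficit (R : realType) (x : R) : -1 < x < 1 ->
  is_derive x 1 (@entropy_deficit R) (log_odds x).
Proof.
move=> /andP[x0 x1].
have := is_derive_lnD1 x0; have := is_derive_lnB1 x1 => h1 h2.
have -> : @entropy_deficit R = (cst 1 + id) * (fun y => ln (1 + y)) +
  (cst 1 - id) * (fun y => ln (1 - y)) by [].
apply: is_derive_eq; rewrite /log_odds /cst !fctE.
rewrite /GRing.scale/=; field; apply/andP; split; lra.
Qed.

Lemma log_odds0 (R : realType) : log_odds (0 : R) = 0.
Proof. by rewrite /log_odds addr0 subr0 subrr. Qed.

(** By convexity of the log-odds on nonnegative arguments: [log_odds x / x] is nondecreasing.
With t = r / s, the function t log_odds x - log_odds (t x) vanishes at 0, and its derivative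
is nonnegative because that of the log-odds increases. *)
Lemma log_odds_ratio_le (R : realType) (r s : R) : 0 <= r -> r <= s -> 0 < s < 1 ->
  log_odds r <= r / s * log_odds s.
Proof.
move=> r0 rs /andP[s0 s1].
set t := r / s.
have t0 : 0 <= t by rewrite divr_ge0// ltW.
have t1 : t <= 1 by rewrite ler_pdivrMr// mul1r.
have -> : r = t * s by rewrite /t divfK// gt_eqF.
rewrite -subr_ge0.
have := @le_of_derive_ge0 R (fun x => t * log_odds x - log_odds (t * x))
  (fun x => t * (2 / (1 - x ^+ 2)) - 2 / (1 - (t * x) ^+ 2) * t) 0 s (ltW s0).
rewrite !mulr0 log_odds0 mulr0 subrr; apply => x /andP[x0 xs].
- have h : is_derive x 1 (fun y : R => t * y) t.
    have -> : (fun y : R => t * y) = t \*: id by [].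
    by apply: is_derive_eq; rewrite /GRing.scale/= mulr1.
  have tx : -1 < t * x < 1 by apply/andP; split; nra.
  have h1 := @is_derive1_comp R (@log_odds R) (fun y => t * y) x _ _
    (is_derive_log_odds tx) h.
  have h2 : is_derive x 1 (@log_odds R) (2 / (1 - x ^+ 2)).
    by apply: is_derive_log_odds; apply/andP; split; lra.
  have -> : (fun x0 : R => t * log_odds x0 - log_odds (t * x0)) =
    (t \*: @log_odds R) - (@log_odds R \o (fun y : R => t * y)) by [].
  by apply: is_derive_eq.
have x2 : 0 < 1 - x ^+ 2 by nra.
have tx2 : 1 - x ^+ 2 <= 1 - (t * x) ^+ 2.
  rewrite lerD2l lerN2 exprMn; apply: ler_piMl; [exact: sqr_ge0|nra].
rewrite [X in _ - X]mulrC -mulrBr mulr_ge0// subr_ge0 ler_pM2l//.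
by rewrite lef_pV2// posrE; lra.
Qed.

Lemma log_odds_ge (R : realType) (r : R) : 0 <= r < 1 -> 2 * r <= log_odds r.
Proof.
move=> /andP[r0 r1]; rewrite -subr_ge0.
have := @le_of_derive_ge0 R (fun x => log_odds x - 2 * x)
  (fun x => 2 / (1 - x ^+ 2) - 2) 0 r r0.
rewrite !mulr0 log_odds0 subrr; apply => x /andP[x0 xs].
- have h2 : is_derive x 1 (@log_odds R) (2 / (1 - x ^+ 2)).
    by apply: is_derive_log_odds; apply/andP; split; lra.
  have -> : (fun y => log_odds y - 2 * y) = @log_odds R - (2%:R \*: id) by [].
  by apply: is_derive_eq; rewrite /GRing.scale/= mulr1.
by rewrite subr_ge0 ler_pdivlMr; nra.
Qed.

(** The leading term of the power series in [r], all of whose coefficients are nonnegative. *)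
Lemma entropy_deficit_ge (R : realType) (r : R) : 0 <= r < 1 -> r ^+ 2 <= entropy_deficit r.
Proof.
move=> /andP[r0 r1]; rewrite -subr_ge0.
have := @le_of_derive_ge0 R (fun x => entropy_deficit x - x ^+ 2)
  (fun x => log_odds x - 2 * x) 0 r r0.
have -> : entropy_deficit 0 = 0 :> R by rewrite /entropy_deficit addr0 subr0 ln1 !mulr0 addr0.
rewrite expr0n subr0.
apply => x /andP[x0 xs].
- have h2 : is_derive x 1 (@entropy_deficit R) (log_odds x).
    by apply: is_derive_entropy_deficit; apply/andP; split; lra.
  have -> : (fun y => entropy_deficit y - y ^+ 2) = @entropy_deficit R - (id ^+ 2) by [].
  by apply: is_derive_eq; rewrite /GRing.scale/= mulr1; ring.
by rewrite subr_ge0 log_odds_ge// x0; lra.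
Qed.

(** The deficit is convex as a function of the squared bias, and this is its tangent at
[c ^+ 2]. The difference of the two sides has derivative log_odds r - (r / c) log_odds c in
[r], which changes sign at [r = c] because the log-odds over the bias is nondecreasing. *)
Lemma entropy_deficit_tangent (R : realType) (c r : R) : 0 < c < 1 -> 0 <= r < 1 ->
  entropy_deficit c + log_odds c / (2 * c) * (r ^+ 2 - c ^+ 2) <= entropy_deficit r.
Proof.
move=> /andP[c0 c1] /andP[r0 r1].
set K := log_odds c / (2 * c).
pose F x := entropy_deficit x - K * x ^+ 2.
pose dF (x : R) := log_odds x - K * (2 * x).
have dFP (x : R) : 0 <= x < 1 -> is_derive x 1 F (dF x).
  move=> /andP[x0 x1].
  have h2 : is_derive x 1 (@entropy_deficit R) (log_odds x).
    by apply: is_derive_entropy_deficit; apply/andP; split; lra.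
  have -> : F = @entropy_deficit R - (K \*: (id ^+ 2)) by [].
  apply: is_derive_eq; rewrite /dF /GRing.scale/= mulr1; ring.
suff : F c <= F r by rewrite /F; lra.
have KE (x : R) : K * (2 * x) = x / c * log_odds c by rewrite /K; field; lra.
have [rc|cr] := leP r c.
- rewrite -lerN2.
  apply: (@le_of_derive_ge0 R (fun x : R => - F x) (fun x : R => - dF x)) => // x /andP[x0 x1].
    have h : is_derive x 1 F (dF x) by apply: dFP; apply/andP; split; lra.
    exact: is_deriveN.
  rewrite oppr_ge0 /dF KE subr_le0.
  by apply: log_odds_ratio_le; [lra|lra|apply/andP; split; lra].
apply: (@le_of_derive_ge0 R F dF); first exact: ltW.
  by move=> x /andP[x0 x1]; apply: dFP; apply/andP; split; lra.
move=> x /andP[x0 x1].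
have x0' : 0 < x by lra.
rewrite /dF KE subr_ge0 -ler_pdivlMl; last by rewrite divr_gt0.
rewrite invf_div; apply: log_odds_ratio_le; [lra|lra|].
by apply/andP; split; lra.
Qed.

Definition entropy_nat (R : realType) (p : R) : R := - p * ln p - (1 - p) * ln (1 - p).

Lemma entropy_natE (R : realType) (p : R) : entropy p = entropy_nat p / ln 2.
Proof. by rewrite /entropy /log2 /entropy_nat; lra. Qed.

Lemma entropy_nat_half (R : realType) (r : R) : 0 <= r < 1 ->
  entropy_nat ((1 - r) / 2) = ln 2 - entropy_deficit r / 2.
Proof.
move=> /andP[r0 r1]; rewrite /entropy_nat /entropy_deficit.
have -> : 1 - (1 - r) / 2 = (1 + r) / 2 by field.
rewrite !ln_div ?posrE; first field; lra.
Qed.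

(** One term of Gibbs' inequality: summed over a distribution [t] and a subdistribution [w],
the correction [w - t] is nonpositive, so the entropy is at most the cross-entropy. *)
Lemma gibbs_term (R : realType) (t w : R) : 0 <= t -> 0 < w ->
  - t * ln t <= - t * ln w + (w - t).
Proof.
rewrite le_eqVlt => /orP[/eqP <-|t0] w0; first by lra.
have wt : 0 < w / t by rewrite divr_gt0.
have : ln (1 + (w / t - 1)) <= w / t - 1 by apply: le_ln1Dx; lra.
rewrite addrC subrK ln_div ?posrE// => /(ler_wpM2l (ltW t0)).
have -> : t * (w / t - 1) = w - t by field; lra.
lra.
Qed.

(** Gibbs' inequality against the binomial weights b^2, 2ab, a^2 with a = (1 - r) / 2 and
b = (1 + r) / 2. The cross-entropy is affine in the probability [l] of the sum 1 and in the
difference 1 - p - q of the probabilities of the sums 0 and 2; it decreases in the latter,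
and the right-hand side is its value when that difference is [r]. *)
Lemma entropy_sum_bits (R : realType) (p q r : R) : 0 <= p <= 1 -> 0 <= q <= 1 ->
  0 <= r < 1 -> r ^+ 2 <= (1 - p - q) ^+ 2 ->
  let l := p * (1 - q) + (1 - p) * q in
  - ((1 - p) * (1 - q)) * ln ((1 - p) * (1 - q)) - l * ln l - (p * q) * ln (p * q)
  <= 2 * entropy_nat ((1 - r) / 2) - l * ln 2.
Proof.
(* Complementing both bits exchanges the sums 0 and 2. *)
wlog pq1 : p q / p + q <= 1.
  move=> H /andP[p0 p1] /andP[q0 q1] rr r2.
  have [?|?] := leP (p + q) 1; first by apply: H => //; apply/andP.
  have := H (1 - p) (1 - q); rewrite /= !subKr.
  have -> : (1 - p) * q + p * (1 - q) = p * (1 - q) + (1 - p) * q by ring.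
  have -> : (p - (1 - q)) ^+ 2 = (1 - p - q) ^+ 2 by ring.
  move=> /(_ _ _ _ rr r2) H'.
  have := H' ltac:(lra) ltac:(lra) ltac:(lra); lra.
move=> /andP[p0 p1] /andP[q0 q1] /andP[r0 r1] r2 /=; set l := p * (1 - q) + (1 - p) * q.
set s := (1 - p) * (1 - q); set t := p * q.
have d0 : r <= 1 - p - q by rewrite -ler_sqr ?nnegrE//; lra.
have s0 : 0 <= s by apply: mulr_ge0; lra.
have t0 : 0 <= t by apply: mulr_ge0; lra.
have l0 : 0 <= l by apply: addr_ge0; apply: mulr_ge0; lra.
have slt : s + l + t = 1 by rewrite /s /l /t; ring.
have st : s - t = 1 - p - q by rewrite /s /t; ring.
pose a := (1 - r) / 2; pose b := (1 + r) / 2.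
have a0 : 0 < a by rewrite /a; lra.
have b0 : 0 < b by rewrite /b; lra.
have hs := gibbs_term s0 (mulr_gt0 b0 b0).
have ht := gibbs_term t0 (mulr_gt0 a0 a0).
have ab0 : 0 < 2 * (a * b) by rewrite mulr_gt0// mulr_gt0.
have hl := gibbs_term l0 ab0.
have ab1 : b * b + 2 * (a * b) + a * a = 1 by rewrite /a /b; field.
rewrite /entropy_nat -/a.
have -> : 1 - a = b by rewrite /a /b; field.
have lab : ln a <= ln b by rewrite ler_ln ?posrE// /a /b; lra.
have lnbb : ln (b * b) = ln b + ln b by rewrite lnM.
have lnaa : ln (a * a) = ln a + ln a by rewrite lnM.
have lnab : ln (2 * (a * b)) = ln 2 + (ln a + ln b).
  have <- : ln (a * b) = ln a + ln b by rewrite lnM.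
  by apply: lnM; rewrite posrE// mulr_gt0.
rewrite lnbb in hs; rewrite lnaa in ht; rewrite lnab in hl.
have E : - s * ln s - l * ln l - t * ln t <=
  - s * (ln b + ln b) - l * (ln 2 + (ln a + ln b)) - t * (ln a + ln a) by lra.
apply: le_trans E _.
have : 0 <= (ln b - ln a) * (s - t - r) by apply: mulr_ge0; lra.
have -> : l = 1 - s - t by lra.
rewrite /a /b; lra.
Qed.

Lemma entropy_nat_ge0 (R : realType) (p : R) : 0 <= p <= 1 -> 0 <= entropy_nat p.
Proof.
move=> /andP[p0 p1]; rewrite /entropy_nat.
have h (x : R) : 0 <= x <= 1 -> x * ln x <= 0.
  by move=> /andP[x0 x1]; rewrite mulr_ge0_le0// ln_le0.
have := h p; have := h (1 - p); lra.
Qed.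

Lemma entropy_nat_tangent (R : realType) (c r : R) : 0 < c < 1 -> 0 <= r < 1 ->
  2 * entropy_nat ((1 - r) / 2) <=
  2 * entropy_nat ((1 - c) / 2) - log_odds c / (2 * c) * (r ^+ 2 - c ^+ 2).
Proof.
move=> c01 r01; have := entropy_deficit_tangent c01 r01.
rewrite !entropy_nat_half//; first lra.
by case/andP: c01 => /ltW-> ->.
Qed.

(** The limit [r --> 1] of the preceding tangent bound, where the entropy vanishes; it covers
coordinates that are deterministic. As the bound is affine in [r ^+ 2], its failure at
1 would show at a smaller [r]. *)
Lemma entropy_nat_tangent1 (R : realType) (c : R) : 0 < c < 1 ->
  0 <= 2 * entropy_nat ((1 - c) / 2) - log_odds c / (2 * c) * (1 - c ^+ 2).
Proof.
move=> c01; have /andP[c0 c1] := c01.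
set K := log_odds c / (2 * c); set H := 2 * _.
have K0 : 0 < K.
  rewrite divr_gt0//; last by lra.
  apply: lt_le_trans (log_odds_ge _); first lra.
  by apply/andP; split; lra.
have HK (r : R) : 0 <= r < 1 -> K * r ^+ 2 <= H + K * c ^+ 2.
  move=> r01; have := entropy_nat_tangent c01 r01.
  have : 0 <= entropy_nat ((1 - r) / 2) by apply: entropy_nat_ge0; lra.
  rewrite -/K -/H; lra.
suff : K <= H + K * c ^+ 2 by lra.
rewrite leNgt; apply/negP; set Q := H + _ => QK.
have Q0 : 0 <= Q by have := HK 0; rewrite expr0n mulr0; apply; lra.
have QK0 : 0 <= Q / K by rewrite divr_ge0// ltW.
have QK1 : Q / K < 1 by rewrite ltr_pdivrMr// mul1r.
have := HK (Num.sqrt ((1 + Q / K) / 2)).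
rewrite sqrtr_ge0 sqr_sqrtr; last lra.
rewrite -[X in _ < X]sqrtr1 ltr_sqrt; last lra.
have -> : K * ((1 + Q / K) / 2) = (K + Q) / 2 by field; lra.
move=> /(_ _)H'; have := H' ltac:(lra); rewrite -/Q; lra.
Qed.

(** The entropy of the sum of two independent bits is bounded by an affine function of the
probability [l] that they differ, namely the tangent at (1 - c^2) / 2 to the concave function
2 h(p) - l, 2 p (1 - p) = l. Affine bounds can be averaged over coordinates and over fibres. *)
Lemma entropy_sum_bits_tangent (R : realType) (p q c : R) :
  0 <= p <= 1 -> 0 <= q <= 1 -> 0 < c < 1 ->
  - ((1 - p) * (1 - q)) * ln ((1 - p) * (1 - q))
  - (p * (1 - q) + (1 - p) * q) * ln (p * (1 - q) + (1 - p) * q)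
  - (p * q) * ln (p * q)
  <= 2 * entropy_nat ((1 - c) / 2) - (p * (1 - q) + (1 - p) * q) * ln 2
     + log_odds c / c * (p * (1 - q) + (1 - p) * q - (1 - c ^+ 2) / 2).
Proof.
move=> p01 q01 c01; have /andP[c0 c1] := c01.
have /andP[p0 p1] := p01; have /andP[q0 q1] := q01.
set l := p * (1 - q) + (1 - p) * q.
have pq0 : 0 <= p * (1 - q) by apply: mulr_ge0; lra.
have qp0 : 0 <= (1 - p) * q by apply: mulr_ge0; lra.
have l0 : 0 <= l by apply: addr_ge0.
have TE : log_odds c / c = 2 * (log_odds c / (2 * c)) by field; lra.
have K0 : 0 < log_odds c / (2 * c).
  rewrite divr_gt0//; last by lra.
  apply: lt_le_trans (log_odds_ge _); first lra.
  by apply/andP; split; lra.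
(* For l = 0 the comparison distribution would have bias 1 and vanishing weights. *)
have [l_gt0|l_le0] := ltP 0 l; last first.
  have le0 : l = 0 by apply: le_anti; rewrite l_le0.
  have h1 : p * (1 - q) = 0 by rewrite /l in le0; lra.
  have h2 : (1 - p) * q = 0 by rewrite /l in le0; lra.
  have pq : p = q by lra.
  rewrite le0 mul0r sub0r.
  have := entropy_nat_tangent1 c01; set K := log_odds c / (2 * c).
  suff [hp|hp] : p = 0 \/ p = 1.
  - rewrite -pq hp !subr0 !mul0r mulr1 ln1; rewrite TE -/K; lra.
  - rewrite -pq hp !subrr !mul0r !mulr1 ln1; rewrite TE -/K; lra.
  move/eqP : h2; rewrite -pq mulf_eq0 subr_eq0 => /orP[/eqP <-|/eqP ->]; by [right|left].
(* The bias matching l is given by r^2 = 1 - 2 l, truncated at 0 when l > 1/2. *)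
pose v := Num.max 0 (1 - 2 * l); pose r := Num.sqrt v.
have v0 : 0 <= v by rewrite /v le_max lexx.
have v1 : v < 1 by rewrite /v gt_max; apply/andP; split; lra.
have r01 : 0 <= r < 1.
  by rewrite sqrtr_ge0/= -[X in _ < X]sqrtr1 ltr_sqrt//; lra.
have r2 : r ^+ 2 = v by rewrite sqr_sqrtr.
have v2 : 1 - 2 * l <= v by rewrite /v le_max lexx orbT.
have := @entropy_sum_bits R p q r p01 q01 r01; rewrite /= -/l => h.
apply: le_trans (h _) _.
  rewrite r2 /v ge_max sqr_ge0/=.
  have -> : 1 - 2 * l = (1 - p - q) ^+ 2 - (p - q) ^+ 2 by rewrite /l; ring.
  by have := sqr_ge0 (p - q); lra.
have := entropy_nat_tangent c01 r01; rewrite r2 TE.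
set K := log_odds c / (2 * c) in K0 *.
have := ler_wpM2l (ltW K0) v2; lra.
Qed.

(** * The function Gamma and its inverse *)

Lemma continuous_entropy (R : realType) (p : R) : 0 < p < 1 -> {for p, continuous (@entropy R)}.
Proof.
move=> /andP[p0 p1]; rewrite /entropy /log2.
have c1 : (fun x : R => 1 - x) x @[x --> p] --> 1 - p by apply: cvgB; [exact: cvg_cst|exact: cvg_id].
have q0 : 0 < 1 - p by lra.
apply: cvgB; apply: cvgM.
- by apply: cvgN; exact: cvg_id.
- by apply: cvgM; [exact: continuous_ln|exact: cvg_cst].
- exact: c1.
- apply: cvgM; last exact: cvg_cst.
  exact: (cvg_comp _ _ c1 (continuous_ln q0)).
Qed.

Lemma Gamma_point_bounds (R : realType) (a : R) : 1 / 3 <= a <= 1 / 2 ->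
  0 < (1 - Num.sqrt (1 - 2 * a)) / 2 < 1.
Proof.
move=> /andP[a3 a2]; have s0 := sqrtr_ge0 (1 - 2 * a).
have s1 : Num.sqrt (1 - 2 * a) < 1 by rewrite -[X in _ < X]sqrtr1 ltr_sqrt//; lra.
lra.
Qed.

Lemma continuous_Gamma (R : realType) (a : R) : 1 / 3 <= a <= 1 / 2 ->
  {for a, continuous (@Gamma R)}.
Proof.
move=> ab; have /andP[a3 a2] := ab; rewrite /Gamma.
have h1 : {for a, continuous (@entropy R)} by apply: continuous_entropy; lra.
have h2 := continuous_entropy (Gamma_point_bounds ab).
have hp : (fun x : R => (1 - Num.sqrt (1 - 2 * x)) / 2) x @[x --> a] -->
    (1 - Num.sqrt (1 - 2 * a)) / 2.
  apply: cvgM; last exact: cvg_cst.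
  apply: cvgB; first exact: cvg_cst.
  have h : (fun x : R => 1 - 2 * x) x @[x --> a] --> 1 - 2 * a.
    apply: cvgB; first exact: cvg_cst.
    by apply: cvgM; [exact: cvg_cst|exact: cvg_id].
  exact: (cvg_comp _ _ h (@sqrt_continuous R _)).
apply: cvgB; first by apply: cvgD; [exact: cvg_cst|exact: h1].
by apply: cvgM; [exact: cvg_cst|exact: (cvg_comp _ _ hp h2)].
Qed.

Lemma Gamma_half (R : realType) : Gamma (1 / 2 : R) = 0.
Proof.
rewrite /Gamma (_ : 1 - 2 * (1 / 2) = 0 :> R); last by field.
rewrite sqrtr0 subr0 /entropy /log2 (_ : 1 - 1 / 2 = 2^-1 :> R); last by field.
rewrite mul1r lnV ?posrE//; field; exact: lt0r_neq0 (ln2_gt0 R).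
Qed.

(** After multiplication by [ln 2] and the bound [c ^+ 2 <= entropy_deficit c] with c^2 = 1/3,
this reduces to ln (4 / 3) <= 1 / 3. *)
Lemma Gamma_third_ge (R : realType) : 1 / 3 <= Gamma (1 / 3 : R).
Proof.
rewrite /Gamma !entropy_natE; set c : R := Num.sqrt _.
have l2 := ln2_gt0 R.
have c2 : c ^+ 2 = 1 / 3 by rewrite sqr_sqrtr; lra.
have c01 : 0 <= c < 1.
  by rewrite sqrtr_ge0/= -[X in _ < X]sqrtr1 ltr_sqrt; lra.
rewrite entropy_nat_half// -(ler_pM2r l2).
have -> : (1 + entropy_nat (1 / 3) / ln 2 - 2 * ((ln 2 - entropy_deficit c / 2) / ln 2)) * ln 2 =
    entropy_nat (1 / 3) - ln 2 + entropy_deficit c by field; lra.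
have := entropy_deficit_ge c01; rewrite c2 /entropy_nat.
have -> : 1 - 1 / 3 = 2 / 3 :> R by field.
rewrite !ln_div ?posrE// ln1.
have : ln (1 + 1 / 3) <= 1 / 3 :> R by apply: le_ln1Dx; lra.
have -> : 1 + 1 / 3 = 2 * 2 / 3 :> R by field.
rewrite ln_div ?posrE ?mulr_gt0// lnM ?posrE//; lra.
Qed.

(** The intermediate value theorem on the interval from 1/3 to 1/2 puts [b] in the image of
[Gamma], so that the pseudo-inverse is a preimage; it is not 1/2, where [Gamma] vanishes. *)
Lemma Gamma_invP (R : realType) (b : R) : 0 < b <= 1 / 3 ->
  1 / 3 <= Gamma_inv b < 1 / 2 /\ Gamma (Gamma_inv b) = b.
Proof.
move=> /andP[b0 b3].
have [a ab Gab] : exists2 a, a \in `[1 / 3, 1 / 2] & Gamma a = b.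
  apply: IVT; first lra.
  - apply: continuous_in_subspaceT => x; rewrite inE/= in_itv/= => xab.
    exact: continuous_Gamma.
  - rewrite Gamma_half; have h := Gamma_third_ge R.
    by rewrite ge_min le_max; apply/andP; split; apply/orP; [right|left]; lra.
have bim : b \in @Gamma R @` `[1 / 3, 1 / 2]%classic by rewrite inE; exists a.
have GK : Gamma (Gamma_inv b) = b by exact: pinvK.
have : Gamma_inv b \in `[1 / 3, 1 / 2].
  have bsurj : set_surj `[1 / 3, 1 / 2]%classic [set b] (@Gamma R) by move=> _ ->; exists a.
  by apply: (surjpinv_image_sub (dflt := fun=> 0) bsurj); exists b.
rewrite in_itv/= => /andP[-> l2]; split=> //=.
rewrite lt_neqAle l2 andbT; apply/eqP => e.
by move: GK; rewrite e Gamma_half => /esym b0'; rewrite b0' ltxx in b0.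
Qed.

(** * Gibbs' inequality for codes *)

(** Gibbs' inequality for the uniform distribution on [P] against [om / W], multiplied by the
cardinal of [P] so that the empty set is covered. *)
Lemma gibbs_card (R : realType) (A : finType) (P : {set A}) (om : A -> R) (W : R) :
  {in P, forall a, 0 < om a} -> \sum_(a in P) om a <= W ->
  #|P|%:R * ln #|P|%:R <= #|P|%:R * ln W - \sum_(a in P) ln (om a).
Proof.
move=> om0 omW; have [->|/set0Pn[a0 a0P]] := eqVneq P finset.set0.
  by rewrite cards0 !mul0r big_set0 subr0.
set N : R := #|P|%:R.
have N0 : 0 < N by rewrite ltr0n card_gt0; apply/set0Pn; exists a0.
have W0 : 0 < W.
  apply: lt_le_trans omW; rewrite (bigD1 a0)//=; apply: ltr_pwDl; first exact: om0.
  by apply: sumr_ge0 => a /andP[aP _]; apply/ltW/om0.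
rewrite -subr_ge0.
have -> : N * ln W - \sum_(a in P) ln (om a) - N * ln N =
  - \sum_(a in P) (ln (om a) + ln N - ln W).
  rewrite !big_split/= !sumr_const -(mulr_natl (ln N)) -(mulr_natl (- ln W)).
  by rewrite -/N; ring.
(* ln x <= x - 1, applied to each x = om a * N / W. *)
rewrite oppr_ge0; apply: (@le_trans _ _ (\sum_(a in P) (om a * N / W - 1))).
  apply: ler_sum => a aP; have oa := om0 _ aP.
  have := @le_ln1Dx R (om a * N / W - 1).
  rewrite addrCA subrr addr0 ln_div ?posrE ?mulr_gt0// lnM ?posrE//; apply.
  by have := divr_gt0 (mulr_gt0 oa N0) W0; lra.
rewrite big_split/= sumr_const -!mulr_suml -(mulr_natl (-1)) -/N mulrN1 subr_le0.
by rewrite ler_pdivrMr// mulrC ler_pM2l.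
Qed.

(** For a fixed value of the side information, a product of subdistributions is a
subdistribution on words, and by injectivity each word is counted at most once. *)
Lemma sum_code_weight (R : realType) (A I J V : finType) (P : {set A}) (U : {set V})
    (u : A -> V) (z : A -> {ffun I -> J}) (w : V -> I -> J -> R) :
  {in P &, injective (fun a => (u a, z a))} ->
  {in P, forall a, u a \in U} ->
  (forall v i j, 0 <= w v i j) -> (forall v i, \sum_j w v i j <= 1) ->
  \sum_(a in P) \prod_i w (u a) i (z a i) <= #|U|%:R.
Proof.
move=> inj uU w0 w1.
pose G (b : V * {ffun I -> J}) := \prod_i w b.1 i (b.2 i).
have G0 b : 0 <= G b by apply: prodr_ge0.
rewrite -(big_imset G inj)/=.
apply: (@le_trans _ _ (\sum_(b | b.1 \in U) G b)).
  rewrite [leRHS](bigID (mem [set (u a, z a) | a in P]%SET))/= ler_wpDr ?sumr_ge0//.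
  rewrite le_eqVlt; apply/orP; left; apply/eqP; apply: eq_bigl => b.
  apply/idP/andP => [bP|[]//]; split=> //.
  by case/imsetP: bP => a aP ->; exact: uU.
have -> : \sum_(b | b.1 \in U) G b =
    \sum_(v in U) \sum_(f : {ffun I -> J}) \prod_i w v i (f i).
  by rewrite pair_big /=; apply: eq_bigl => b; rewrite andbT.
rewrite -sum1_card natr_sum; apply: ler_sum => v _.
rewrite -bigA_distr_bigA/=; apply: Num.Theory.prodr_ile1 => i _.
by rewrite w1 sumr_ge0.
Qed.

(** The letters of a code are bounded by a memoryless model [w] that may depend on side
information [u] with at most [#|U|] values: the logarithm of the size of the code is at most
the logarithm of [#|U|] plus the average code length under the model. *)
Lemma code_entropy_le (R : realType) (A I J V : finType) (P : {set A}) (U : {set V})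
    (u : A -> V) (z : A -> {ffun I -> J}) (w : V -> I -> J -> R) :
  {in P &, injective (fun a => (u a, z a))} ->
  {in P, forall a, u a \in U} ->
  (forall v i j, 0 <= w v i j) -> (forall v i, \sum_j w v i j <= 1) ->
  {in P, forall a i, 0 < w (u a) i (z a i)} ->
  #|P|%:R * ln #|P|%:R <= #|P|%:R * ln #|U|%:R
    - \sum_(a in P) \sum_i ln (w (u a) i (z a i)).
Proof.
move=> inj uU w0 w1 wP.
have -> : \sum_(a in P) \sum_i ln (w (u a) i (z a i)) =
    \sum_(a in P) ln (\prod_i w (u a) i (z a i)).
  apply: eq_bigr => a aP.
  suff : 0 < \prod_i w (u a) i (z a i) /\
    \sum_i ln (w (u a) i (z a i)) = ln (\prod_i w (u a) i (z a i)) by case.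
  elim/big_rec2: _ => [|i x y _ [y0 ->]]; first by rewrite ln1.
  by rewrite lnM ?posrE ?mulr_gt0// ?wP.
apply: gibbs_card => [a aP|]; first by rewrite prodr_gt0// => i _; rewrite wP.
exact: sum_code_weight.
Qed.

(** * Pairs that differ on a prescribed set of coordinates *)

Definition diffset n (xy : cube n * cube n) : {set 'I_n} :=
  [set i | xy.1 i != xy.2 i]%SET.

(** The letter at a coordinate records the integer sum: [None] is 1, [Some b] is [b + b]. *)
Definition sum_symbol n (xy : cube n * cube n) : {ffun 'I_n -> option bool} :=
  [ffun i => if xy.1 i == xy.2 i then Some (xy.1 i) else None].

Definition cut_pairs n (X Y : {set cube n}) (S : {set 'I_n}) : {set cube n * cube n} :=
  [set xy in finset.setX X Y | S \subset diffset xy]%SET.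

Lemma sum_symbol_inj n (X Y : {set cube n}) : unique_sum_pair X Y ->
  {in finset.setX X Y &, injective (@sum_symbol n)}.
Proof.
case/unique_sum_pairP => _ _ inj a b aXY bXY ab; apply: inj => //.
apply/ffunP => i; rewrite !ffunE.
move/ffunP/(_ i): ab; rewrite !ffunE.
by case: (a.1 i) (a.2 i) (b.1 i) (b.2 i) => [] [] [] [].
Qed.

Lemma big_option_bool (R : realType) (F : option bool -> R) :
  \sum_j F j = F None + F (Some true) + F (Some false).
Proof.
rewrite (bigD1 None)//= (bigD1 (Some true))//= (bigD1 (Some false))//= big1 ?addr0 ?addrA//.
by case=> [[]|].
Qed.

Lemma sum_symbol_eq_None n (xy : cube n * cube n) i : (sum_symbol xy i == None) = (i \in diffset xy).
Proof. by rewrite ffunE inE; case: (xy.1 i) (xy.2 i) => [] []. Qed.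

(** The model gives probability [lam] to the sum 1 and shares the rest equally between 0 and 2
(and is deterministic on [S]). The average code length is affine in the average distance,
with slope ln ((1 - lam) / (2 lam)), nonpositive because [lam] is at least 1/3. *)
Lemma cut_pairs_large_distance (R : realType) n (X Y : {set cube n}) (S : {set 'I_n})
    (lam : R) : unique_sum_pair X Y -> 1 / 3 <= lam < 1 ->
  lam * #|~: S|%:R * #|cut_pairs X Y S|%:R <=
    \sum_(xy in cut_pairs X Y S) #|diffset xy :\: S|%:R ->
  #|cut_pairs X Y S|%:R * ln #|cut_pairs X Y S|%:R <=
  #|cut_pairs X Y S|%:R * (#|~: S|%:R * (entropy_nat lam + (1 - lam) * ln 2)).
Proof.
move=> usp /andP[lam3 lam1]; set P := cut_pairs X Y S; set m := #|~: S|.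
move=> hL.
have lam0 : 0 < lam by lra.
pose w (v : unit) (i : 'I_n) (j : option bool) : R :=
  if i \in S then (j == None)%:R else if j is Some _ then (1 - lam) / 2 else lam.
have PP a : a \in P -> a \in finset.setX X Y /\ S \subset diffset a.
  by rewrite inE => /andP[].
have wE a : a \in P -> \sum_i ln (w tt i (sum_symbol a i)) =
    #|diffset a :\: S|%:R * ln lam + (m%:R - #|diffset a :\: S|%:R) * ln ((1 - lam) / 2).
  move=> aP; have [_ SD] := PP _ aP.
  rewrite (bigID (mem S))/= big1 ?add0r; last first.
    by move=> i iS; rewrite /w iS sum_symbol_eq_None (fintype.subsetP SD)// ln1.
  rewrite (bigID (mem (diffset a)))/=.
  rewrite [X in X + _](_ : _ = \sum_(i in diffset a :\: S) ln lam); last first.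
    apply: eq_big => [i|i /andP[iS]]; first by rewrite finset.in_setD.
    by rewrite -sum_symbol_eq_None => /eqP ->; rewrite /w (negbTE iS).
  rewrite [X in _ + X](_ : _ = \sum_(i in ~: S :\: diffset a) ln ((1 - lam) / 2)); last first.
    apply: eq_big => [i|i /andP[iS]]; first by rewrite !inE andbC.
    by rewrite -sum_symbol_eq_None /w (negbTE iS); case: (sum_symbol a i).
  rewrite !sumr_const -(mulr_natl (ln lam)) -(mulr_natl (ln ((1 - lam) / 2))); congr (_ + _ * _).
  have -> : m = (#|diffset a :\: S| + #|~: S :\: diffset a|)%N.
    rewrite /m -(cardsID (diffset a) (~: S)); congr (_ + _)%N.
    by apply: eq_card => i; rewrite !inE andbC.
  by rewrite natrD addrAC subrr add0r.
have := @code_entropy_le R _ _ _ _ P finset.setT (fun=> tt) (@sum_symbol n) w.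
rewrite cardsT card_unit ln1 mulr0 sub0r => H.
apply: le_trans (H _ _ _ _ _) _ => {H}.
- move=> a b aP bP [ab]; apply: (sum_symbol_inj usp) => //.
  + by case: (PP _ aP).
  + by case: (PP _ bP).
- by [].
- move=> v i j; rewrite /w; case: ifP => // _; case: j => [_|]; lra.
- move=> v i; rewrite big_option_bool /w; case: ifP => //= _; lra.
- move=> a aP i; have [_ SD] := PP _ aP.
  rewrite /w; case: ifP => [iS|_].
    by rewrite sum_symbol_eq_None (fintype.subsetP SD).
  by case: (sum_symbol a i) => [_|]; lra.
rewrite (eq_bigr _ wE) big_split/= -!mulr_suml big_split/= sumr_const sumrN.
set L : R := \sum_(i in P) _ in hL *.
rewrite -(mulr_natl m%:R) ln_div ?posrE; try lra.
set p : R := #|P|%:R in hL *.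
rewrite /entropy_nat.
have : ln (1 - lam) - ln 2 <= ln lam.
  by rewrite -ln_div ?posrE; [rewrite ler_ln ?posrE; lra|lra|lra].
rewrite -subr_ge0 => h.
have := ler_wpM2r h hL; lra.
Qed.

Lemma sum_by_value (R : realType) (A J : finType) (P : {set A}) (g : A -> J) (F : J -> R) :
  \sum_(a in P) F (g a) = \sum_j #|[set a in P | g a == j]%SET|%:R * F j.
Proof.
rewrite (partition_big g xpredT)//=; apply: eq_bigr => j _.
rewrite (eq_bigr (fun=> F j)) => [|a /andP[_ /eqP ->]//].
by rewrite sumr_const mulr_natl; congr (_ *+ _); apply: eq_card => a; rewrite inE.
Qed.

(** On a product set the two bits at coordinate [i] are independent, so the empirical entropy of
their sum obeys the tangent bound for independent bits. Everything is multiplied by the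
cardinal of the product. *)
Lemma product_coordinate_entropy (R : realType) n (A B : {set cube n}) (i : 'I_n) (c : R)
    (C := finset.setX A B) : 0 < c < 1 ->
  - \sum_(a in C) ln (#|[set b in C | sum_symbol b i == sum_symbol a i]%SET|%:R / #|C|%:R)
  <= #|C|%:R * (2 * entropy_nat ((1 - c) / 2) - log_odds c / c * ((1 - c ^+ 2) / 2))
     + (log_odds c / c - ln 2) * #|[set a in C | i \in diffset a]%SET|%:R :> R.
Proof.
move=> c01.
have [C0|Cn0] := eqVneq C finset.set0.
  rewrite C0 big_set0 cards0 oppr0 mul0r add0r.
  rewrite (_ : [set a in _ | _]%SET = finset.set0) ?cards0 ?mulr0//.
  by apply/finset.setP => a; rewrite !inE.
pose N j : R := #|[set b in C | sum_symbol b i == j]%SET|%:R.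
rewrite (sum_by_value C (fun a => sum_symbol a i) (fun j => ln (N j / #|C|%:R))).
rewrite big_option_bool -!/(N _).
have -> : #|[set a in C | i \in diffset a]%SET|%:R = N None.
  by congr (_%:R); apply: eq_card => a; rewrite !inE ffunE; case: (a.1 i) (a.2 i) => [] [].
pose A1 := [set x in A | x i]%SET; pose A0 := A :\: A1.
pose B1 := [set x in B | x i]%SET; pose B0 := B :\: B1.
have A1A : A1 \subset A by apply/fintype.subsetP => x; rewrite inE => /andP[].
have B1B : B1 \subset B by apply/fintype.subsetP => x; rewrite inE => /andP[].
pose a : R := #|A|%:R; pose b : R := #|B|%:R.
have [A_gt0 B_gt0] : (0 < #|A|)%N /\ (0 < #|B|)%N.
  by apply/andP; rewrite -muln_gt0 -cardsX card_gt0.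
have a0 : 0 < a by rewrite ltr0n.
have b0 : 0 < b by rewrite ltr0n.
pose p : R := #|A1|%:R / a; pose q : R := #|B1|%:R / b.
have p01 : 0 <= p <= 1.
  by rewrite divr_ge0 ?ler0n ?(ltW a0)//= ler_pdivrMr// mul1r ler_nat subset_leq_card.
have q01 : 0 <= q <= 1.
  by rewrite divr_ge0 ?ler0n ?(ltW b0)//= ler_pdivrMr// mul1r ler_nat subset_leq_card.
have cA1 : #|A1|%:R = p * a by rewrite /p divfK// gt_eqF.
have cB1 : #|B1|%:R = q * b by rewrite /q divfK// gt_eqF.
have cA0 : #|A0|%:R = (1 - p) * a.
  rewrite mulrBl -cA1 mul1r cardsD (finset.setIidPr A1A) natrB// subset_leq_card//.
have cB0 : #|B0|%:R = (1 - q) * b.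
  rewrite mulrBl -cB1 mul1r cardsD (finset.setIidPr B1B) natrB// subset_leq_card//.
have cC : #|C|%:R = a * b by rewrite cardsX natrM.
have N1 : N (Some true) = p * q * (a * b).
  rewrite mulrACA -cA1 -cB1 -natrM -cardsX; congr (_%:R); apply: eq_card => x.
  by rewrite !inE ffunE; case: (x.1 \in A) (x.2 \in B) (x.1 i) (x.2 i) => [] [] [] [].
have N0 : N (Some false) = (1 - p) * (1 - q) * (a * b).
  rewrite mulrACA -cA0 -cB0 -natrM -cardsX; congr (_%:R); apply: eq_card => x.
  by rewrite !inE ffunE; case: (x.1 \in A) (x.2 \in B) (x.1 i) (x.2 i) => [] [] [] [].
have NN : N None = (p * (1 - q) + (1 - p) * q) * (a * b).
  have -> : N None = a * b - N (Some true) - N (Some false).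
    have := sum_by_value C (fun a => sum_symbol a i) (fun=> 1 : R).
    rewrite big_option_bool !mulr1 -!/(N _) sumr_const cC => ->; ring.
  by rewrite N1 N0; ring.
rewrite N1 N0 NN cC !mulfK ?mulf_neq0 ?gt_eqF//.
have := ler_wpM2r (ltW (mulr_gt0 a0 b0)) (entropy_sum_bits_tangent p01 q01 c01).
lra.
Qed.

Lemma card_set_sum_indicator (R : realType) (A : finType) (P : {set A}) (Q : pred A) :
  #|[set a in P | Q a]%SET|%:R = \sum_(a in P) (Q a)%:R :> R.
Proof.
rewrite -sum1_card natr_sum; under eq_bigl do rewrite finset.in_set.
by rewrite big_mkcondr/=; apply: eq_bigr => a _; case: (Q a).
Qed.

(** The side information is the restriction of [x] to [S]. Since [x] and [y] differ on all of
[S], it also fixes [y] there, so that its fibres are product sets; the model is the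
empirical distribution of each coordinate of the sum in each fibre. The tangent bounds
have nonnegative slope in the distance, which is where the upper bound on the average
distance enters. *)
Lemma cut_pairs_small_distance (R : realType) n (X Y : {set cube n}) (S : {set 'I_n})
    (c : R) : unique_sum_pair X Y -> 0 < c < 1 ->
  \sum_(xy in cut_pairs X Y S) #|diffset xy :\: S|%:R <=
    (1 - c ^+ 2) / 2 * #|~: S|%:R * #|cut_pairs X Y S|%:R ->
  #|cut_pairs X Y S|%:R * ln #|cut_pairs X Y S|%:R <=
  #|cut_pairs X Y S|%:R * (#|S|%:R * ln 2 +
    #|~: S|%:R * (2 * entropy_nat ((1 - c) / 2) - (1 - c ^+ 2) / 2 * ln 2)).
Proof.
move=> usp c01; have /andP[c0 c1] := c01.
set P := cut_pairs X Y S; set m : R := #|~: S|%:R; set lam := (1 - c ^+ 2) / 2.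
move=> hL.
pose u (xy : cube n * cube n) := [set i in S | xy.1 i]%SET.
pose Pv v := [set a in P | u a == v]%SET.
pose w v i (j : option bool) : R :=
  #|[set b in Pv v | sum_symbol b i == j]%SET|%:R / #|Pv v|%:R.
pose Av v := [set x in X | [set i in S | x i] == v]%SET.
pose Bv v := [set y in Y | [set i in S | ~~ y i] == v]%SET.
have PP a : a \in P -> a \in finset.setX X Y /\ S \subset diffset a.
  by rewrite inE => /andP[].
have inPv a v : (a \in Pv v) = (a \in P) && (u a == v) by rewrite [LHS]inE.
(* On S the words x and y of a cut pair are complementary. *)
have PvE v : Pv v = finset.setX (Av v) (Bv v).
  apply/finset.setP => -[x y].
  apply/idP/idP.
    rewrite inE => /andP[/PP[]]; rewrite finset.in_setX => /andP[xX yY] /fintype.subsetP SD /eqP uv.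
    rewrite finset.in_setX inE xX/= -{1}uv eqxx/= inE yY/= -uv; apply/eqP/finset.setP => i.
    rewrite !inE; case: (boolP (i \in S)) => //= iS.
    by have := SD _ iS; rewrite inE/=; case: (x i) (y i) => [] [].
  rewrite finset.in_setX inE => /andP[/andP[xX /eqP xv]]; rewrite inE => /andP[yY /eqP yv].
  rewrite inE /u /= xv eqxx andbT inE finset.in_setX xX yY/=.
  apply/fintype.subsetP => i iS; move/finset.setP/(_ i): yv; rewrite -xv !inE iS/=.
  by case: (x i) (y i) => [] [].
have wE (v : {set 'I_n}) (i : 'I_n) : i \in S ->
    {in Pv v, forall a, w v i (sum_symbol a i) = 1}.
  move=> iS a aPv.
  have zN b : b \in Pv v -> sum_symbol b i = None.
    rewrite inE => /andP[/PP[_ /fintype.subsetP/(_ _ iS)]].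
    by rewrite -sum_symbol_eq_None => /eqP.
  rewrite /w (zN _ aPv) (_ : [set b in Pv v | _]%SET = Pv v).
    by rewrite divff// pnatr_eq0 -lt0n card_gt0; apply/set0Pn; exists a.
  apply/finset.setP => b; rewrite inE; case: (boolP (b \in Pv v)) => //= bP.
  by rewrite zN.
have := @code_entropy_le R _ _ _ _ P (powerset S) u (@sum_symbol n) w.
rewrite card_powerset natrX lnXn// -[ln 2 *+ _]mulr_natl => H.
apply: le_trans (H _ _ _ _ _) _ => {H}.
- move=> a b aP bP [_ ab]; apply: (sum_symbol_inj usp) => //.
  + by case: (PP _ aP).
  + by case: (PP _ bP).
- by move=> a aP; rewrite powersetE; apply/fintype.subsetP => i; rewrite inE => /andP[].
- by move=> v i j; rewrite divr_ge0.
- move=> v i; rewrite -mulr_suml.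
  have := sum_by_value (Pv v) (fun a => sum_symbol a i) (fun=> 1 : R).
  rewrite sumr_const; under [in RHS]eq_bigr do rewrite mulr1; move=> <-.
  by have [->|n0] := eqVneq (#|Pv v|%:R : R) 0; rewrite ?mul0r// divff.
- move=> a aP i; have aPv : a \in Pv (u a) by rewrite inE aP eqxx.
  rewrite divr_gt0 ?ltr0n// card_gt0; apply/set0Pn; exists a => //.
  by apply/finset.setIdP; rewrite eqxx.
set K := 2 * entropy_nat ((1 - c) / 2) - log_odds c / c * lam.
set kap := log_odds c / c - ln 2.
(* log_odds c / c >= 2 > ln 2. *)
have kap0 : 0 <= kap.
  have := @ln_sublinear R 2 ltac:(lra); have := @log_odds_ge R c ltac:(lra).
  rewrite -ler_pdivlMr// /kap; lra.
have key (v : {set 'I_n}) (i : 'I_n) : i \notin S ->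
    - \sum_(a in Pv v) ln (w v i (sum_symbol a i)) <=
    #|Pv v|%:R * K + kap * #|[set a in Pv v | i \in diffset a]%SET|%:R.
  by move=> iS; rewrite /w PvE; exact: product_coordinate_entropy.
have split (F : cube n * cube n -> R) :
    \sum_(a in P) F a = \sum_v \sum_(a in Pv v) F a.
  rewrite (partition_big u xpredT)//=; apply: eq_bigr => v _.
  by apply: eq_bigl => a; rewrite inPv.
have bound : - \sum_(a in P) \sum_i ln (w (u a) i (sum_symbol a i)) <=
    #|P|%:R * (m * K) + kap * \sum_(a in P) #|diffset a :\: S|%:R.
  rewrite exchange_big/= (bigID (mem S))/= big1 ?add0r; last first.
    move=> i iS; rewrite big1// => a aP.
    by rewrite (wE _ _ iS) ?ln1// inPv aP eqxx.
  rewrite -sumrN.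
  apply: (@le_trans _ _ (\sum_(i in ~: S) (#|P|%:R * K +
      kap * #|[set a in P | i \in diffset a]%SET|%:R))).
    under [leRHS]eq_bigl do rewrite inE.
    apply: ler_sum => i iS; rewrite split -sumrN.
    have -> : #|P|%:R = \sum_v #|Pv v|%:R :> R.
      have := split (fun=> 1); rewrite sumr_const => ->.
      by apply: eq_bigr => v _; rewrite sumr_const.
    have -> : #|[set a in P | i \in diffset a]%SET|%:R =
        \sum_v #|[set a in Pv v | i \in diffset a]%SET|%:R :> R.
      rewrite card_set_sum_indicator split; apply: eq_bigr => v _.
      by rewrite card_set_sum_indicator.
    rewrite mulr_suml mulr_sumr -big_split/=; apply: ler_sum => v _.
    apply: le_trans (key v i iS); rewrite lerN2 le_eqVlt; apply/orP; left; apply/eqP.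
    by apply: eq_bigr => a; rewrite inPv => /andP[_ /eqP ->].
  rewrite big_split/= sumr_const -mulr_sumr -(mulr_natl _ #|~: S|) -/m mulrCA lerD2l.
  apply: ler_wpM2l => //; rewrite (eq_bigr (fun i => \sum_(a in P) (i \in diffset a)%:R)); last first.
    by move=> i _; rewrite card_set_sum_indicator.
  rewrite exchange_big/=; apply: ler_sum => a aP.
  rewrite -card_set_sum_indicator ler_nat subset_leq_card//.
  by apply/fintype.subsetP => i; rewrite !inE.
have hE : #|P|%:R * (m * (2 * entropy_nat ((1 - c) / 2) - lam * ln 2)) =
    #|P|%:R * (m * K) + kap * (lam * m * #|P|%:R) by rewrite /K /kap; ring.
by rewrite mulrDr lerD2l hE (le_trans bound)// lerD2l ler_wpM2l.
Qed.

(** With [lam] the point where the two bounds on the size coincide, one of them applies whatever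
the average distance is. The hypothesis reads #|S| <= #|~: S| * Gamma lam. *)
Lemma cut_pairs_card_le (R : realType) n (X Y : {set cube n}) (S : {set 'I_n}) (lam : R) :
  unique_sum_pair X Y -> 1 / 3 <= lam < 1 / 2 ->
  #|S|%:R * ln 2 <= #|~: S|%:R *
    (entropy_nat lam + ln 2 - 2 * entropy_nat ((1 - Num.sqrt (1 - 2 * lam)) / 2)) ->
  #|cut_pairs X Y S|%:R <= expR (#|~: S|%:R * (entropy_nat lam + (1 - lam) * ln 2)).
Proof.
move=> usp /andP[lam3 lam2] hS; set c := Num.sqrt _ in hS.
have [P0|Pn0] := posnP #|cut_pairs X Y S|; first by rewrite P0 expR_ge0.
have p0 : 0 < #|cut_pairs X Y S|%:R :> R by rewrite ltr0n.
rewrite -(@lnK _ #|cut_pairs X Y S|%:R) ?posrE// ler_expR -(ler_pM2l p0).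
have c2 : c ^+ 2 = 1 - 2 * lam by rewrite sqr_sqrtr//; lra.
have c01 : 0 < c < 1.
  apply/andP; split; first by rewrite sqrtr_gt0; lra.
  by rewrite -[X in _ < X]sqrtr1 ltr_sqrt//; lra.
have [hL|hL] := leP (lam * #|~: S|%:R * #|cut_pairs X Y S|%:R)
    (\sum_(xy in cut_pairs X Y S) #|diffset xy :\: S|%:R).
  by apply: cut_pairs_large_distance => //; lra.
have lamE : (1 - c ^+ 2) / 2 = lam by rewrite c2; field.
have := @cut_pairs_small_distance R n X Y S c usp c01.
rewrite lamE => /(_ (ltW hL)) h; apply: le_trans h _.
by rewrite ler_pM2l//; lra.
Qed.

(** * Double counting over the sets of coordinates *)

Definition flip n (x : cube n) : cube n := [ffun i => ~~ x i].

Lemma flipK n : involutive (@flip n).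
Proof. by move=> x; apply/ffunP => i; rewrite !ffunE negbK. Qed.

(** If x - y = x' - y' then x + y' = x' + y: exchanging the second components turns a
coincidence of differences into one of sums. *)
Lemma unique_sum_pair_flip n (X Y : {set cube n}) :
  unique_sum_pair X Y -> unique_sum_pair X [set y | flip y \in Y]%SET.
Proof.
case/unique_sum_pairP => X0 /set0Pn[y0 y0Y] inj; apply/unique_sum_pairP; split=> //.
  by apply/set0Pn; exists (flip y0); rewrite inE flipK.
move=> -[x y] [x' y']; rewrite !finset.in_setX !inE/= => /andP[xX yY] /andP[x'X y'Y] e.
have := inj (x, flip y') (x', flip y).
rewrite !finset.in_setX/= xX yY x'X y'Y => /(_ isT isT) H.
suff: (x, flip y') = (x', flip y) by case=> -> /(can_inj (@flipK n)) ->.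
by apply: H; apply/ffunP => i; move/ffunP/(_ i): e; rewrite !ffunE/=;
  case: (x i) (y i) (x' i) (y' i) => [] [] [] [].
Qed.

Lemma sum_card_cut_pairs n (X Y : {set cube n}) k :
  \sum_(S : {set 'I_n} | #|S| == k) #|cut_pairs X Y S| =
  \sum_(xy in finset.setX X Y) 'C(#|diffset xy|, k).
Proof.
under eq_bigr do rewrite -sum1_card.
rewrite (exchange_big_dep (mem (finset.setX X Y)))/=; last first.
  by move=> S xy _; rewrite inE => /andP[].
apply: eq_bigr => xy xyXY; rewrite sum1_card -cards_draws.
by apply: eq_card => S; rewrite [RHS]finset.in_set [LHS]unfold_in finset.in_set xyXY andbC.
Qed.

(** Each pair (x, y) of [X] and [Y] is counted by the sets of [k] coordinates on which x and y
differ and by those on which they agree; the latter are the cut pairs of [X] and of the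
complemented [Y]. Among 2N coordinates, one of the two kinds comprises at least N. *)
Lemma card_product_le (R : realType) N (X Y : {set cube (N + N)}) k (lam : R) :
  unique_sum_pair X Y -> 1 / 3 <= lam < 1 / 2 -> (k <= N)%N ->
  k%:R * ln 2 <= (N + N - k)%:R *
    (entropy_nat lam + ln 2 - 2 * entropy_nat ((1 - Num.sqrt (1 - 2 * lam)) / 2)) ->
  (#|X| * #|Y| * 'C(N, k))%:R <=
    2 * 'C(N + N, k)%:R * expR ((N + N - k)%:R * (entropy_nat lam + (1 - lam) * ln 2)).
Proof.
move=> usp lamb kN hk.
set Y' := [set y | flip y \in Y]%SET.
set E := expR _.
have sumle Z : unique_sum_pair X Z ->
    (\sum_(xy in finset.setX X Z) 'C(#|diffset xy|, k))%:R <= 'C(N + N, k)%:R * E.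
  move=> usZ; rewrite -sum_card_cut_pairs natr_sum.
  rewrite -[X in 'C(X, k)]card_ord -card_draws -sum1_card natr_sum mulr_suml.
  under [leRHS]eq_bigl do rewrite inE.
  apply: ler_sum => S /eqP Sk; rewrite mul1r /E.
  have hSc : #|~: S| = (N + N - k)%N by rewrite cardsCs finset.setCK Sk card_ord.
  by rewrite -hSc; apply: cut_pairs_card_le => //; rewrite Sk hSc.
have := lerD (sumle Y usp) (sumle Y' (unique_sum_pair_flip usp)).
rewrite -natrD -mulrA mulr2n mulrDl mul1r; apply: le_trans.
rewrite ler_nat.
have -> : \sum_(xy in finset.setX X Y') 'C(#|diffset xy|, k) =
    \sum_(xy in finset.setX X Y) 'C(#|~: diffset xy|, k).
  have ginj : injective (fun xy : cube (N + N) * cube (N + N) => (xy.1, flip xy.2)).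
    by move=> [x y] [x' y'] /= [-> /(can_inj (@flipK _)) ->].
  rewrite (reindex_inj ginj)/=; apply: eq_big => [[x y]|[x y] _].
    by rewrite !finset.in_setX inE/= flipK.
  congr 'C(_, _); apply: eq_card => i; rewrite !inE ffunE.
  by case: (x i) (y i) => [] [].
rewrite -cardsX -big_split/= -sum_nat_const; apply: leq_sum => xy _.
have cD : (#|diffset xy| + #|~: diffset xy| = N + N)%N by rewrite cardsC card_ord.
have [h|h] := leqP N #|diffset xy|.
  by apply: leq_trans (leq_addr _ _); rewrite leq_bin2l.
by apply: leq_trans (leq_addl _ _); rewrite leq_bin2l// -(leq_add2l #|diffset xy|) cD leq_add2r ltnW.
Qed.

(** * Exponential bounds on binomial coefficients *)

Lemma binomial_term_sum (R : realType) (q : R) N :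
  \sum_(j < N.+1) 'C(N, j)%:R * (q ^+ j * (1 - q) ^+ (N - j)) = 1.
Proof.
have E := exprDn (1 - q) q N; rewrite subrK expr1n in E; rewrite [RHS]E.
by apply: eq_bigr => j _; rewrite mulr_natl [q ^+ j * _]mulrC.
Qed.

(** One term of the expansion of (q + (1 - q))^n is at most the sum. *)
Lemma binomial_le (R : realType) (q : R) n k : 0 < q < 1 -> (k <= n)%N ->
  ln 'C(n, k)%:R <= - k%:R * ln q - (n - k)%:R * ln (1 - q).
Proof.
move=> /andP[q0 q1] kn.
have q1' : 0 < 1 - q by lra.
have C0 : 0 < 'C(n, k)%:R :> R by rewrite ltr0n bin_gt0.
have Q0 : 0 < q ^+ k * (1 - q) ^+ (n - k) by rewrite mulr_gt0// exprn_gt0.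
have : 'C(n, k)%:R * (q ^+ k * (1 - q) ^+ (n - k)) <= 1.
  rewrite -[X in _ <= X](binomial_term_sum q n) (bigD1 (Ordinal (kn : (k < n.+1)%N)))//= lerDl.
  by apply: sumr_ge0 => j _; rewrite mulr_ge0 ?ler0n// mulr_ge0// exprn_ge0// ltW.
move/ln_le0; rewrite lnM ?posrE// lnM ?posrE ?exprn_gt0// !lnXn//.
rewrite -(mulr_natl (ln q)) -(mulr_natl (ln (1 - q))); lra.
Qed.

(** The terms of (q + (1 - q))^N increase up to index N q and decrease afterwards, up to a
factor 2 at the top, so that the term at the integer part [k] of N q is at least half of the
average 1 / (N + 1). *)
Lemma binomial_ge (R : realType) (q : R) N k : 0 < q <= 1 / 2 ->
  k%:R <= N%:R * q < k.+1%:R ->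
  - k%:R * ln q - (N - k)%:R * ln (1 - q) <= ln 'C(N, k)%:R + ln (2 * N.+1%:R).
Proof.
move=> /andP[q0 q2] /andP[kN Nk].
have q1 : 0 < 1 - q by lra.
pose t j := 'C(N, j)%:R * (q ^+ j * (1 - q) ^+ (N - j)) : R.
have Q0 j : 0 < q ^+ j * (1 - q) ^+ (N - j) by rewrite mulr_gt0// exprn_gt0.
have t0 j : 0 <= t j by rewrite mulr_ge0// ltW.
have tS j : (j < N)%N -> t j.+1 * (j.+1%:R * (1 - q)) = t j * ((N%:R - j%:R) * q).
  move=> jN; have e : (N - j = (N - j.+1).+1)%N by lia.
  have := mul_bin_left N j => /(congr1 (fun x => x%:R : R)); rewrite !natrM natrB 1?ltnW// => E.
  rewrite /t e !exprS.
  transitivity (j.+1%:R * 'C(N, j.+1)%:R * (q * q ^+ j * ((1 - q) * (1 - q) ^+ (N - j.+1)))).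
    by ring.
  by rewrite E; ring.
have pos j : 0 < j.+1%:R * (1 - q) by rewrite mulr_gt0.
have le_down j : (k < j)%N -> (j < N)%N -> t j.+1 <= t j.
  move=> kj jN; rewrite -(ler_pM2r (pos j)) tS//; apply: ler_wpM2l => //.
  have : k.+1%:R <= j%:R :> R by rewrite ler_nat.
  by rewrite -[j.+1%:R]natr1; lra.
have le_up j : (j < k)%N -> t j <= t j.+1.
  move=> jk.
  have jk' : j.+1%:R <= k%:R :> R by rewrite ler_nat.
  have jN : (j < N)%N.
    have : k%:R < N.+1%:R :> R by rewrite -natr1; have := ler0n R N; nra.
    by rewrite ltr_nat; lia.
  rewrite -natr1 in jk'.
  have p : 0 < (N%:R - j%:R) * q.
    by rewrite mulr_gt0// subr_gt0 ltr_nat.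
  rewrite -(ler_pM2r p) -tS//; apply: ler_wpM2l => //.
  by rewrite -[j.+1%:R]natr1; lra.
have le_k : (k < N)%N -> t k.+1 <= 2 * t k.
  move=> kN'; rewrite -(ler_pM2r (pos k)) tS// (_ : 2 * t k * _ = t k * (2 * (k.+1%:R * (1 - q)))); last by ring.
  apply: ler_wpM2l => //.
  have : 0 <= k%:R * q by rewrite mulr_ge0// ltW.
  have : k.+1%:R * q <= k.+1%:R * (1 / 2) by apply: ler_wpM2l.
  lra.
have le_all j : (j <= N)%N -> t j <= 2 * t k.
  move=> jN; have [jk|kj] := leqP j k.
    have h : t j <= t k.
      elim: k jk {kN Nk le_down le_k} le_up => [|k' IH].
        by rewrite leqn0 => /eqP ->.
      rewrite leq_eqVlt => /orP[/eqP -> //|jk le_up].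
      apply: le_trans (IH _ _) (le_up k' _) => // i ik; apply: le_up; lia.
    by have := t0 k; lra.
  have kN' : (k < N)%N by lia.
  apply: le_trans (le_k kN').
  elim: j kj jN => // j IH kj jN; have [->//|kj'] : j = k \/ (k < j)%N by lia.
  by apply: le_trans (le_down _ kj' jN) (IH _ _); lia.
have kN' : (k <= N)%N.
  have : k%:R < N.+1%:R :> R by rewrite -natr1; have := ler0n R N; nra.
  by rewrite ltr_nat; lia.
have : 1 <= 'C(N, k)%:R * (q ^+ k * (1 - q) ^+ (N - k)) * (2 * N.+1%:R).
  rewrite -[X in X <= _](binomial_term_sum q N).
  have -> : t k * (2 * N.+1%:R) = \sum_(j < N.+1) 2 * t k.
    by rewrite sumr_const card_ord -(mulr_natl _ N.+1); ring.
  by apply: ler_sum => j _; apply: le_all; have := ltn_ord j; lia.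
have C0 : 0 < 'C(N, k)%:R :> R by rewrite ltr0n bin_gt0.
have W0 : 0 < 2 * N.+1%:R :> R by rewrite mulr_gt0.
move/ln_ge0; rewrite lnM3// lnM ?posrE ?exprn_gt0// !lnXn//.
rewrite -(mulr_natl (ln q)) -(mulr_natl (ln (1 - q))); lra.
Qed.

(** * Existence of the optimal rate *)

Lemma max_unique_sum_le n (X Y : {set cube n}) : unique_sum_pair X Y ->
  (#|X| * #|Y| <= max_unique_sum n)%N.
Proof.
move=> usp.
exact: (@leq_bigmax_cond _ (fun XY : {set cube n} * {set cube n} => unique_sum_pair XY.1 XY.2)
  (fun XY => #|XY.1| * #|XY.2|)%N (X, Y) usp).
Qed.

Lemma max_unique_sum_gt0 n : (0 < max_unique_sum n)%N.
Proof.
pose x0 : cube n := [ffun=> false].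
have usp : unique_sum_pair [set x0]%SET [set x0]%SET.
  apply/unique_sum_pairP; split; try by apply/set0Pn; exists x0; rewrite inE.
  by move=> [a b] [a' b']; rewrite !finset.in_setX !inE/= => /andP[/eqP -> /eqP ->] /andP[/eqP -> /eqP ->].
by apply: leq_trans (max_unique_sum_le usp); rewrite !cards1.
Qed.

Lemma max_unique_sum_attained n : exists XY : {set cube n} * {set cube n},
  unique_sum_pair XY.1 XY.2 /\ max_unique_sum n = (#|XY.1| * #|XY.2|)%N.
Proof.
have := max_unique_sum_gt0 n; rewrite /max_unique_sum.
elim/big_ind: _ => [//|a b Ha Hb|XY usp _]; last by exists XY.
by rewrite /maxn; case: ifP.
Qed.

Lemma max_unique_sum_bound n : (max_unique_sum n <= 4 ^ n)%N.
Proof.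
apply/bigop.bigmax_leqP => -[X Y] _ /=; rewrite (expnMn 2 2).
have cardc : #|{: cube n}| = (2 ^ n)%N by rewrite card_ffun card_bool card_ord.
by apply: leq_mul; rewrite -cardc max_card.
Qed.

Definition cat_cube m n (xy : cube m * cube n) : cube (m + n) :=
  [ffun i => match fintype.split i with inl j => xy.1 j | inr j => xy.2 j end].

Lemma cat_cube_l m n (x : cube m) (y : cube n) j : cat_cube (x, y) (lshift n j) = x j.
Proof. by rewrite ffunE (unsplitK (inl j)). Qed.

Lemma cat_cube_r m n (x : cube m) (y : cube n) j : cat_cube (x, y) (rshift m j) = y j.
Proof. by rewrite ffunE (unsplitK (inr j)). Qed.

Lemma cat_cube_inj m n : injective (@cat_cube m n).
Proof.
move=> [x y] [x' y'] e; congr (_, _); apply/ffunP => j; move/ffunP: e => e.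
  by have := e (lshift n j); rewrite !cat_cube_l.
by have := e (rshift m j); rewrite !cat_cube_r.
Qed.

(** Concatenating the words of two unique-sum pairs gives a unique-sum pair. *)
Lemma max_unique_sumM m n :
  (max_unique_sum m * max_unique_sum n <= max_unique_sum (m + n))%N.
Proof.
have [[X Y] /= [usXY ->]] := max_unique_sum_attained m.
have [[X' Y'] /= [usXY' ->]] := max_unique_sum_attained n.
have cX (Z : {set cube m}) (Z' : {set cube n}) :
    (#|Z| * #|Z'|)%N = #|(@cat_cube m n @: finset.setX Z Z')%SET|.
  by rewrite card_imset ?cardsX//; exact: cat_cube_inj.
rewrite mulnACA !cX.
apply: max_unique_sum_le; apply/unique_sum_pairP.
have [X0 Y0 inj] := unique_sum_pairP _ _ usXY.
have [X'0 Y'0 inj'] := unique_sum_pairP _ _ usXY'.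
have ne0 (Z : {set cube m}) (Z' : {set cube n}) : Z != finset.set0 -> Z' != finset.set0 ->
    (@cat_cube m n @: finset.setX Z Z')%SET != finset.set0.
  move=> /set0Pn[z zZ] /set0Pn[z' zZ']; apply/set0Pn; exists (cat_cube (z, z')).
  by apply: imset_f; rewrite finset.in_setX zZ.
split; try exact: ne0.
move=> [x y] [u v]; rewrite !finset.in_setX => /andP[/imsetP[[x1 x2] hx ->] /imsetP[[y1 y2] hy ->]].
move=> /andP[/imsetP[[u1 u2] hu ->] /imsetP[[v1 v2] hv ->]] e.
move: hx hy hu hv; rewrite !finset.in_setX => /andP[hx1 hx2] /andP[hy1 hy2] /andP[hu1 hu2] /andP[hv1 hv2].
have [-> ->] : (x1, y1) = (u1, v1).
  apply: inj; rewrite ?finset.in_setX ?hx1 ?hu1//; apply/ffunP => j.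
  by move/ffunP/(_ (lshift n j)): e; rewrite !ffunE /= !(unsplitK (inl j)).
have [-> ->] : (x2, y2) = (u2, v2).
  apply: inj'; rewrite ?finset.in_setX ?hx2 ?hu2//; apply/ffunP => j.
  by move/ffunP/(_ (rshift m j)): e; rewrite !ffunE /= !(unsplitK (inr j)).
by [].
Qed.

(** Fekete's lemma: the limit is the supremum. Indeed u n is at least the integer part of n / m
times u m, and so at least n u m / m up to a constant. *)
Lemma superadditive_cvg (R : realType) (u : nat -> R) (C : R) :
  (forall m n, u m + u n <= u (m + n)%N) -> (forall n, 0 <= u n <= C * n%:R) ->
  cvgn (fun n => u n / n%:R).
Proof.
move=> usup ub.
pose A := [set u n / n%:R | n in [set n | (0 < n)%N]]%classic.
have C0 : 0 <= C by have := ub 1%N; lra.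
have Aub : ubound A C.
  move=> _ [n n0 <-]; rewrite ler_pdivrMr ?ltr0n//.
  by case/andP: (ub n).
have hA : has_sup A by split; [exists (u 1%N / 1%:R); exists 1%N|exists C].
pose L := sup A.
apply/cvg_ex; exists L; apply/cvgrPdist_le => e e0.
have e2 : 0 < e / 2 by lra.
have [_ [m /= m0 <-] hm] := sup_adherent e2 hA.
have m0R : 0 < m%:R :> R by rewrite ltr0n.
have uq q : q%:R * u m <= u (q * m)%N.
  elim: q => [|q IH]; first by rewrite mul0r mul0n; case/andP: (ub 0%N).
  rewrite mulSn -natr1 mulrDl mul1r addrC.
  by apply: le_trans (usup _ _); rewrite lerD2l.
pose N0 := (Num.truncn (2 * m%:R * C / e)).+1.
exists N0 => // n /= N0n.
have n0 : (0 < n)%N by apply: leq_trans N0n.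
have n0R : 0 < n%:R :> R by rewrite ltr0n.
have nbig : 2 * m%:R * C <= e * n%:R.
  rewrite [leRHS]mulrC -ler_pdivrMr//; apply: le_trans (ltW (truncnS_gt _)) _.
  by rewrite ler_nat.
have unL : u n / n%:R <= L by apply: ub_le_sup; [case: hA|exists n].
rewrite ger0_norm ?subr_ge0// lerBlDr -lerBlDl.
apply: (@le_trans _ _ (u m / m%:R - e / 2)); first by rewrite /L; lra.
have hq : (n%:R - m%:R) / m%:R * u m <= u n.
  apply: (@le_trans _ _ ((n %/ m)%N%:R * u m)).
    apply: ler_wpM2r; first by case/andP: (ub m).
    rewrite ler_pdivrMr// lerBlDr -natrM -natrD ler_nat.
    by rewrite {1}(divn_eq n m) leq_add2l ltnW// ltn_pmod.
  apply: le_trans (uq _) _.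
  rewrite {2}(divn_eq n m); apply: le_trans (usup _ _).
  by rewrite lerDl; case/andP: (ub (n %% m)%N).
rewrite ler_pdivlMr//; apply: le_trans hq.
have um : u m / m%:R <= C by rewrite ler_pdivrMr//; case/andP: (ub m).
have -> : (n%:R - m%:R) / m%:R * u m = n%:R * (u m / m%:R) - m%:R * (u m / m%:R).
  by field; lra.
have := ler_wpM2l (ltW m0R) um; lra.
Qed.

(** * The upper bound on the rate *)

(** The error terms are a constant coming from rounding [k] (the exponent is affine in [k]) and
the logarithm of the polynomial factor in the lower bound on ['C(N, k)]. *)
Lemma ln_max_unique_sum_le (R : realType) (a : R) : 0 < a <= 1 / 4 ->
  exists c0 : R, 0 <= c0 /\ forall N, ln (max_unique_sum (N + N))%:R <=
    (N + N)%:R * (ln 2 * Rate a) + ln (2 * N.+1%:R) + c0.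
Proof.
move=> /andP[a0 a4]; have l2 := ln2_gt0 R.
have b13 : 0 < a / (1 - a) <= 1 / 3.
  by rewrite divr_gt0 ?ler_pdivrMr//=; lra.
have [/andP[lam3 lam2] Glam] := Gamma_invP b13.
set lam := Gamma_inv (a / (1 - a)) in lam3 lam2 Glam.
set G := entropy_nat lam + (1 - lam) * ln 2.
(* B is the slope in k of the exponent of the bound; rounding N * (2 * a) down to k costs at
   most its absolute value. *)
pose B := ln 2 + ln (1 - a) - ln (1 - 2 * a) - G.
exists (ln 2 + `|B|); split; first by rewrite addr_ge0// ltW.
move=> N.
have Na0 : 0 <= N%:R * (2 * a) by rewrite mulr_ge0// mulr_ge0// ltW.
pose k := Num.truncn (N%:R * (2 * a)).
have /andP[kN Nk] : k%:R <= N%:R * (2 * a) < k.+1%:R by exact: truncn_itv.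
have kleN : (k <= N)%N.
  rewrite -(ler_nat R) (le_trans kN)// -[leRHS]mulr1 ler_wpM2l//; lra.
have kNN : (k <= N + N)%N by apply: leq_trans kleN (leq_addr N N).
have [[X Y] /= [usXY ME]] := max_unique_sum_attained (N + N).
have mE : (N + N - k)%:R = N%:R + N%:R - k%:R :> R by rewrite natrB// natrD.
have hGam : entropy_nat lam + ln 2 -
    2 * entropy_nat ((1 - Num.sqrt (1 - 2 * lam)) / 2) = ln 2 * (a / (1 - a)).
  by rewrite -Glam /Gamma !entropy_natE; field; lra.
have hk : k%:R * ln 2 <= (N + N - k)%:R * (entropy_nat lam + ln 2 -
    2 * entropy_nat ((1 - Num.sqrt (1 - 2 * lam)) / 2)).
  rewrite hGam mE mulrCA [leLHS]mulrC ler_pM2l// mulrA ler_pdivlMr; lra.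
have := card_product_le usXY (introT andP (conj lam3 lam2)) kleN hk.
rewrite -ME natrM -/G.
have M0 : 0 < (max_unique_sum (N + N))%:R :> R by rewrite ltr0n max_unique_sum_gt0.
have C0 : 0 < 'C(N, k)%:R :> R by rewrite ltr0n bin_gt0.
have D0 : 0 < 'C(N + N, k)%:R :> R by rewrite ltr0n bin_gt0.
move=> hM; have h : ln (max_unique_sum (N + N))%:R + ln 'C(N, k)%:R <=
    ln 2 + ln 'C(N + N, k)%:R + (N + N - k)%:R * G.
  rewrite -lnM ?posrE// -(expRK ((N + N - k)%:R * G)) -lnM3 ?expR_gt0//.
  by rewrite ler_ln ?posrE ?mulr_gt0 ?expR_gt0.
have a01 : 0 < a < 1 by lra.
have a2' : 0 < 2 * a <= 1 / 2 by lra.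
have h1 := binomial_le a01 kNN.
have kNk : k%:R <= N%:R * (2 * a) < k.+1%:R by rewrite kN.
have h2 := binomial_ge a2' kNk.
have l2a : ln (2 * a) = ln 2 + ln a by rewrite lnM ?posrE.
rewrite natrB// l2a in h2; rewrite mE in h h1.
have RE : ln 2 * Rate a = a * ln 2 - (1 - a) * ln (1 - a) +
    (1 - 2 * a) / 2 * ln (1 - 2 * a) + (1 - a) * G.
  rewrite /Rate -/lam !entropy_natE /G /entropy_nat lnM ?posrE//; field; lra.
rewrite RE natrD.
have hB : (k%:R - N%:R * (2 * a)) * B <= `|B|.
  apply: le_trans (ler_norm _) _; rewrite normrM ler_piMl// ler_norml.
  by rewrite -natr1 in Nk; apply/andP; split; lra.
rewrite /B in hB *; move: hB; set nB := `|_|.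
lra.
Qed.

(** Along the dimensions 2 j^2 the logarithmic error term is of order j, by the crude bound
ln x < x, and so is negligible against j^2. *)
Theorem theorem1p1 (R : realType) :
  optimal_rate R <= inf [set Rate a | a in [set a : R | 0 < a <= 1 / 4]].
Proof.
have l2 := ln2_gt0 R.
have cv : cvgn (fun n : nat => log2 (max_unique_sum n)%:R / n%:R : R).
  apply: (@superadditive_cvg R (fun n => log2 (max_unique_sum n)%:R) 2) => [m n|n].
    rewrite /log2 -mulrDl ler_pM2r ?invr_gt0// -lnM ?posrE ?ltr0n ?max_unique_sum_gt0//.
    rewrite -natrM ler_ln ?posrE ?ltr0n ?muln_gt0 ?max_unique_sum_gt0// ler_nat.
    exact: max_unique_sumM.
  have M1 : 1 <= (max_unique_sum n)%:R :> R by rewrite ler1n max_unique_sum_gt0.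
  apply/andP; split; first by rewrite divr_ge0 ?(ltW l2)// ln_ge0.
  rewrite ler_pdivrMr//.
  apply: (@le_trans _ _ (ln ((2 * 2) ^+ n))).
    rewrite ler_ln ?posrE ?exprn_gt0//; last by lra.
    by rewrite -!natrM -natrX ler_nat max_unique_sum_bound.
  by rewrite lnXn// lnM ?posrE// -(mulr_natl _ n); lra.
apply: lb_le_inf; first by exists (Rate (1 / 4)); exists (1 / 4) => //=; lra.
move=> _ [a /= ha <-].
have [c0 [c00 hc]] := ln_max_unique_sum_le ha.
rewrite /optimal_rate; set L := limn _.
apply/ler_addgt0Pl => e e0.
have e2 : 0 < e / 2 by lra.
move/cvgrPdist_le : cv => /(_ _ e2)[N0 _ hN]; rewrite -/L in hN.
pose j := (N0 + (Num.truncn ((4 + c0) / (e * ln 2))).+1)%N.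
have hj : 4 + c0 <= j%:R * (e * ln 2).
  rewrite -ler_pdivrMr ?mulr_gt0//; apply: le_trans (ltW (truncnS_gt _)) _.
  by rewrite ler_nat leq_addl.
have j_gt0 : (0 < j)%N by rewrite /j addnS.
have j1 : 1 <= j%:R :> R by rewrite ler1n.
have jN : (N0 <= j * j + j * j)%N.
  apply: leq_trans (leq_addr _ _); apply: leq_trans (leq_pmulr _ j_gt0).
  exact: leq_addr.
have lnj : ln (2 * (j * j).+1%:R) <= 4 * j%:R :> R.
  apply: (@le_trans _ _ (ln ((2 * j%:R) ^+ 2))).
    rewrite ler_ln ?posrE ?exprn_gt0 ?mulr_gt0 ?ltr0n//.
    have -> : (j * j).+1%:R = j%:R * j%:R + 1 :> R by rewrite -natrM natr1.
    nra.
  have j2 : 0 < 2 * j%:R :> R by lra.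
  rewrite lnXn// -[ln _ *+ 2]mulr_natl; have := ln_sublinear j2; lra.
have := hN _ jN; rewrite /= ler_norml => /andP[_].
suff : log2 (max_unique_sum (j * j + j * j))%:R / (j * j + j * j)%:R <=
  Rate a + e / 2 by lra.
have hjj := hc (j * j)%N.
have jj0 : 0 < (j * j + j * j)%:R :> R by rewrite ltr0n addn_gt0 muln_gt0 j_gt0.
rewrite /log2 ler_pdivrMr// ler_pdivrMr//; apply: le_trans hjj _.
rewrite natrD natrM.
have := ler_wpM2l (ltW (lt_le_trans ltr01 j1)) hj.
have : c0 <= j%:R * c0 by rewrite ler_peMl.
lra.
Qed.
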